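(* Let $m\ge3$ and let $\delta$ be a decoration of $G_2(m)$. The spectral profile $(|T_0^\delta|,|T_1^\delta|,\dots,|T_{m-3}^\delta|)$ is uniquely determined by the overlap invariants $q_\delta^{(0)},q_\delta^{(1)},\dots,q_\delta^{(m-3)}$ via the explicit inversion formulas $$|T_i^\delta|=\sum_{p=i}^{m-3}(-1)^{p-i}\binom pi q_\delta^{(p)},\qquad 0\le i\le m-3.$$
   Context: Let $\Omega=\{1,\dots,m\}$. The Grassmannian geometry $G_2(m)$ has points the $2$-subsets $ij$ of $\Omega$ and blocks $b_{ijk}=\{ij,ik,jk\}$, one for each $3$-subset $\{i,j,k\}\subseteq\Omega$; $\mathcal B$ is the set of blocks and $\operatorname{supp}(b_{ijk})=\{i,j,k\}$. A decoration is a map $\delta:\mathcal B\to\{\pm1\}$. For a $4$-subset $\rho=\{i,j,k,r\}$ of $\Omega$, the Pasch configuration $P_\rho=\{b_{ijk},b_{ijr},b_{ikr},b_{jkr}\}$ has sign $\kappa_\delta(P_\rho)=\delta(b_{ijk})\delta(b_{ijr})\delta(b_{ikr})\delta(b_{jkr})$. Put $\mathcal N_\delta=\{\rho\in\binom{\Omega}{4}:\kappa_\delta(P_\rho)=-1\}$ (negative Pasch configurations). For a block $b$, $d_\delta(b)=|\{\rho\in\mathcal N_\delta:\operatorname{supp}(b)\subset\rho\}|$, and $T_k^\delta=\{b\in\mathcal B:d_\delta(b)=k\}$. The overlap invariants are: $q_\delta^{(0)}=\binom m3$, $q_\delta^{(1)}=4|\mathcal N_\delta|$, and for $p\ge2$,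 $q_\delta^{(p)}$ is the number of subsets $S\subseteq\mathcal N_\delta$ with $|S|=p$ and $\bigl|\bigcap_{\rho\in S}\rho\bigr|=3$. *)

(* Defs.v *)
From mathcomp Require Import all_boot all_order all_algebra.

Set Implicit Arguments.
Unset Strict Implicit.
Unset Printing Implicit Defensive.

(* Omega is 'I_m; subsets of Omega are {set 'I_m}, and a block, being a set   *)
(* of points, is a {set {set 'I_m}}.                                          *)

Definition points (m : nat) : {set {set 'I_m}} :=
  [set x : {set 'I_m} | #|x| == 2].

(* b_{ijk} is block_of [set i; j; k]; see block_ofE.                          *)
Definition block_of (m : nat) (s : {set 'I_m}) : {set {set 'I_m}} :=
  [set x in points m | x \subset s].

Definition blocks (m : nat) : {set {set {set 'I_m}}} :=
  [set block_of s | s : {set 'I_m} & #|s| == 3].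

(* The union of the points of b, so that supp b_{ijk} = {i, j, k}; see        *)
(* supp_block_of.                                                             *)
Definition supp (m : nat) (b : {set {set 'I_m}}) : {set 'I_m} := cover b.

(* Only the values of delta on blocks are constrained, and only they are used *)
(* below.                                                                     *)
Definition is_decoration (m : nat) (delta : {set {set 'I_m}} -> int) : Prop :=
  {in blocks m, forall b, delta b = 1%R \/ delta b = (-1)%R}.

(* See paschE for the explicit list of the four blocks.                       *)
Definition pasch (m : nat) (rho : {set 'I_m}) : {set {set {set 'I_m}}} :=
  [set b in blocks m | supp b \subset rho].

Definition pasch_sign (m : nat) (delta : {set {set 'I_m}} -> int)
    (rho : {set 'I_m}) : int :=
  (\prod_(b in pasch rho) delta b)%R.

Definition neg_pasch (m : nat) (delta : {set {set 'I_m}} -> int) :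
    {set {set 'I_m}} :=
  [set rho : {set 'I_m} | (#|rho| == 4) && (pasch_sign delta rho == (-1)%R)].

Definition degree (m : nat) (delta : {set {set 'I_m}} -> int)
    (b : {set {set 'I_m}}) : nat :=
  #|[set rho in neg_pasch delta | supp b \subset rho]|.

Definition spectral_class (m : nat) (delta : {set {set 'I_m}} -> int)
    (k : nat) : {set {set {set 'I_m}}} :=
  [set b in blocks m | degree delta b == k].

Definition spectral_profile (m : nat) (delta : {set {set 'I_m}} -> int) :
    seq nat :=
  mkseq (fun k => #|spectral_class delta k|) (m - 3).+1.

Definition overlap (m : nat) (delta : {set {set 'I_m}} -> int) (p : nat) :
    nat :=
  match p with
  | 0 => 'C(m, 3)
  | 1 => 4 * #|neg_pasch delta|
  | _ => #|[set S : {set {set 'I_m}} | [&& S \subset neg_pasch delta,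
              #|S| == p & #|\bigcap_(rho in S) rho| == 3]]|
  end.

Lemma block_ofE (m : nat) (i j k : 'I_m) :
  i != j -> i != k -> j != k ->
  block_of [set i; j; k] = [set [set i; j]; [set i; k]; [set j; k]].
Proof.
move=> ij ik jk; apply/setP => x; rewrite !inE.
apply/andP/idP => [[/cards2P [a [b [ab ->]]]] | ].
  rewrite subUset !sub1set !inE => /andP[].
  case/orP=> [/orP[]|] /eqP ea; case/orP=> [/orP[]|] /eqP eb;
    move: ab; rewrite ea eb ?eqxx // => _;
    by rewrite ?(setUC [set j] [set i]) ?(setUC [set k] [set i])
      ?(setUC [set k] [set j]) ?eqxx ?orbT.
by case/orP=> [/orP[]|] /eqP ->; rewrite cards2 ?ij ?ik ?jk; split=> //;
  rewrite subUset !sub1set !inE ?eqxx ?orbT.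
Qed.

Lemma supp_block_of (m : nat) (s : {set 'I_m}) :
  #|s| == 3 -> supp (block_of s) = s.
Proof.
move=> s3; apply/setP => x; apply/bigcupP/idP => [[y] | xs].
  by rewrite inE => /andP[_ /subsetP ys] /ys.
have : 0 < #|s :\ x| by move: s3; rewrite (cardsD1 x) xs add1n => /eqP [->].
case/card_gt0P => y; rewrite !inE => /andP[yx ys].
exists [set x; y]; last by rewrite !inE eqxx.
by rewrite !inE cards2 (eq_sym x) yx subUset !sub1set xs ys.
Qed.

Lemma paschE (m : nat) (i j k r : 'I_m) :
  uniq [:: i; j; k; r] ->
  pasch [set i; j; k; r] =
  [set block_of [set i; j; k]; block_of [set i; j; r];
       block_of [set i; k; r]; block_of [set j; k; r]].
Proof.
rewrite /= !inE !negb_or => /and4P[/and3P[ij ik ir] /andP[jk jr] kr _].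
have c3 (a b c : 'I_m) : a != b -> a != c -> b != c -> #|[set a; b; c]| == 3.
  move=> ab ac bc; rewrite setUC cardsU1 !inE negb_or cards2 ab.
  by rewrite !(eq_sym c) ac bc.
have c4 : #|[set i; j; k; r]| = 4.
  rewrite setUC cardsU1 !inE !negb_or (eqP (c3 _ _ _ ij ik jk)).
  by rewrite !(eq_sym r) ir jr kr.
apply/setP => b; rewrite 2!inE; apply/andP/idP.
  case=> /imsetP[s]; rewrite inE => s3 ->; rewrite supp_block_of // => ss.
  have : #|[set i; j; k; r] :\: s| == 1.
    by rewrite cardsD c4 (setIidPr ss) (eqP s3).
  case/cards1P => t et.
  have es : s = [set i; j; k; r] :\ t
    by rewrite -et setDDr setDv set0U (setIidPr ss).
  have : t \in [set i; j; k; r].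
    by have : t \in [set t] by [rewrite inE]; rewrite -et => /setDP[].
  rewrite !inE => /orP[/orP[/orP[]|]|] /eqP tt; subst t.
  - suff -> : s = [set j; k; r] by rewrite eqxx ?orbT.
    rewrite es; apply/setP => x; rewrite !inE; case: (eqVneq x i) => [->|] //=.
    by rewrite (negPf ij) (negPf ik) (negPf ir).
  - suff -> : s = [set i; k; r] by rewrite eqxx ?orbT.
    rewrite es; apply/setP => x; rewrite !inE; case: (eqVneq x j) => [->|] //=.
      by rewrite eq_sym (negPf ij) (negPf jk) (negPf jr).
    by rewrite orbF.
  - suff -> : s = [set i; j; r] by rewrite eqxx ?orbT.
    rewrite es; apply/setP => x; rewrite !inE; case: (eqVneq x k) => [->|] //=.
      by rewrite !(eq_sym k) (negPf ik) (negPf jk) eq_sym (negPf kr).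
    by rewrite orbF.
  - suff -> : s = [set i; j; k] by rewrite eqxx ?orbT.
    rewrite es; apply/setP => x; rewrite !inE; case: (eqVneq x r) => [->|] //=.
      by rewrite !(eq_sym r) (negPf ir) (negPf jr) (negPf kr).
    by rewrite orbF.
rewrite !inE => /orP[/orP[/orP[]|]|] /eqP ->; rewrite supp_block_of ?c3 //;
  (split; first by apply/imsetP; eexists; last reflexivity; rewrite inE c3 //);
  by rewrite !subUset !sub1set !inE ?eqxx ?orbT.
Qed.

(* Main.v *)
(** Counting pairs (s, S) with s a 3-subset contained in every member of a
    p-subset S of N in two ways gives
      sum_s C(d(s), p) = sum_S C(|cap S|, 3),
    and the right-hand side is the p-th overlap invariant: for p = 0 the empty
    intersection is Omega, for p = 1 each term is C(4, 3) = 4, and for p >= 2 two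
    distinct 4-subsets meet in at most three points. As d(s) <= m - 3, binomial inversion
    recovers the number of s with d(s) = i. *)
Require Import Defs.
From mathcomp Require Import all_boot all_order all_algebra.

Set Implicit Arguments.
Unset Strict Implicit.
Unset Printing Implicit Defensive.

Import GRing.Theory.
Local Open Scope ring_scope.

(** Multiplied by i! k! (d - i - k)!, both sides become d!. *)
Lemma mul_bin_trinomial (d i k : nat) : (i + k <= d)%N ->
  ('C(d, i + k) * 'C(i + k, i) = 'C(d, i) * 'C(d - i, k))%N.
Proof.
move=> led; have leid : (i <= d)%N := leq_trans (leq_addr k i) led.
have lekd : (k <= d - i)%N by rewrite leq_subRL.
apply/eqP; rewrite -(@eqn_pmul2r (i`! * k`! * (d - i - k)`!)%N);
  last by rewrite !muln_gt0 !fact_gt0.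
apply/eqP; transitivity d`!.
  rewrite -(bin_fact led) -(bin_fact (leq_addr k i)) addKn subnDA.
  by rewrite !mulnA.
rewrite -(bin_fact leid) -(bin_fact lekd) -!mulnA; congr (_ * _)%N.
by rewrite mulnCA; congr (_ * _)%N; rewrite mulnCA.
Qed.

(** Terms with p > d vanish; by [mul_bin_trinomial] the rest sum to C(d, i) (1 - 1)^(d - i). *)
Lemma binomial_inversion_delta (M d i : nat) : (d <= M)%N ->
  \sum_(i <= p < M.+1) (-1) ^+ (p - i) * ('C(p, i))%:Z * ('C(d, p))%:Z
    = (d == i)%:Z.
Proof.
move=> dM; case: (ltnP d i) => [ltdi | leid].
  rewrite ltn_eqF // big_nat big1 // => p /andP[ip _].
  by rewrite (bin_small (leq_trans ltdi ip)) mulr0.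
rewrite (@big_cat_nat _ _ _ d.+1) //=; last exact: leqW.
rewrite [X in _ + X]big_nat [X in _ + X]big1 ?addr0; last first.
  by move=> p /andP[dp _]; rewrite (bin_small dp) mulr0.
(* Substitute p = k + i with 0 <= k <= d - i. *)
rewrite -{1}[i]add0n big_addn subSn // big_mkord.
have eterm (k : 'I_(d - i).+1) : true ->
    (-1) ^+ (k + i - i) * ('C(k + i, i))%:Z * ('C(d, k + i))%:Z
    = ('C(d, i))%:Z * ((-1) ^+ k *+ 'C(d - i, k)) :> int.
  move=> _; have led : (i + k <= d)%N by rewrite -leq_subRL // -ltnS.
  rewrite addnK -mulrA -PoszM mulnC addnC mul_bin_trinomial // PoszM.
  by rewrite mulrCA -mulr_natr natz.
rewrite (eq_bigr _ eterm) -big_distrr /=.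
suff -> : \sum_(k < (d - i).+1) (-1) ^+ k *+ 'C(d - i, k) = (d == i)%:Z.
  by case: eqP => [->|_]; rewrite ?binn ?mulr1 ?mulr0.
transitivity ((1 - 1 : int) ^+ (d - i)).
  by rewrite exprBn; apply: eq_bigr => k _; rewrite !expr1n !mulr1.
(* Here 0 ^+ 0 = 1 accounts for the case d = i. *)
by rewrite subrr expr0n subn_eq0 eqn_leq leid andbT natz.
Qed.

Lemma card_lt_setI (T : finType) (A B : {set T}) :
  A != B -> #|A| = #|B| -> (#|A :&: B| < #|A|)%N.
Proof.
move=> AB cAB; apply: proper_card; rewrite properEneq subsetIl andbT.
apply: contraNneq AB => /setIidPl sAB.
by rewrite eqEcard sAB cAB leqnn.
Qed.

(** Two distinct members of size k already meet in fewer than k points. *)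
Lemma card_bigcap_lt (T : finType) (S : {set {set T}}) (k : nat) :
  (1 < #|S|)%N -> {in S, forall A : {set T}, #|A| = k} ->
  (#|\bigcap_(A in S) A| < k)%N.
Proof.
case/card_gt1P => A [B [AS BS AB]] cS.
rewrite -(cS A AS); apply: leq_ltn_trans (card_lt_setI AB _).
  by apply: subset_leq_card; rewrite subsetI !bigcap_inf.
by rewrite !cS.
Qed.

Lemma sum_bin_card_above (T : finType) (N : {set {set T}}) (k p : nat) :
  (\sum_(s : {set T} | #|s| == k) 'C(#|[set A in N | s \subset A]|, p)
   = \sum_(S : {set {set T}} | (S \subset N) && (#|S| == p))
       'C(#|\bigcap_(A in S) A|, k))%N.
Proof.
under eq_bigr => s _ do rewrite -cards_draws -sum1dep_card.
under [RHS]eq_bigr => S _ do rewrite -cards_draws -sum1dep_card.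
(* With each binomial written as a sum of ones over subsets, both sides run over the pairs (s, S);
   it remains to swap the sums and match the conditions. *)
rewrite (exchange_big_dep (fun S : {set {set T}} =>
  (S \subset N) && (#|S| == p))) /=; last first.
  move=> s S _ /andP[/subsetP SN ->]; rewrite andbT.
  by apply/subsetP => A /SN; rewrite inE => /andP[].
apply: eq_bigr => S /andP[/subsetP SN Sp]; apply: eq_bigl => s.
rewrite Sp andbT andbC; congr andb.
apply/subsetP/bigcapsP => [sS A /sS | sS A AS]; first by rewrite inE => /andP[].
by rewrite inE SN // sS.
Qed.

(** A member of N containing s is [x |: s] for some x outside s, so these members lie in an image of
    the complement of s. *)
Lemma card_supersets1_le (T : finType) (N : {set {set T}}) (s : {set T}) :
  {in N, forall A : {set T}, #|A| = #|s|.+1} ->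
  (#|[set A in N | s \subset A]| <= #|T| - #|s|)%N.
Proof.
move=> cN; rewrite -(cardsC s) addKn.
apply: leq_trans (leq_imset_card (fun x => x |: s) (~: s)).
apply: subset_leq_card; apply/subsetP => A; rewrite inE => /andP[AN sA].
have : #|A :\: s| == 1%N by rewrite cardsD (setIidPr sA) cN // subSnn.
case/cards1P => x Ex; apply/imsetP; exists x.
  by have := set11 x; rewrite -Ex !inE => /andP[].
by rewrite -Ex setUC -{1}(setID A s) (setIidPr sA).
Qed.

Lemma card_neg_pasch_elt (m : nat) (delta : {set {set 'I_m}} -> int) :
  {in neg_pasch delta, forall rho : {set 'I_m}, #|rho| = 4%N}.
Proof. by move=> rho; rewrite inE => /andP[/eqP]. Qed.

(** On 3-subsets [block_of] is injective, since [supp] recovers s. *)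
Lemma sum_blocks (m : nat) (V : nmodType) (F : {set {set 'I_m}} -> V) :
  \sum_(b in blocks m) F b
    = \sum_(s : {set 'I_m} | #|s| == 3) F (block_of s).
Proof.
rewrite /blocks big_imset /=; first by apply: eq_bigl => s; rewrite inE.
move=> s t; rewrite !inE => s3 t3 est.
by rewrite -(supp_block_of s3) est supp_block_of.
Qed.

Lemma degree_le (m : nat) (delta : {set {set 'I_m}} -> int) :
  {in blocks m, forall b, (degree delta b <= m - 3)%N}.
Proof.
move=> b /imsetP[s]; rewrite inE => s3 ->.
have := @card_supersets1_le _ (neg_pasch delta) s.
rewrite card_ord (eqP s3) /degree supp_block_of //; apply.
exact: card_neg_pasch_elt.
Qed.

Lemma overlap_sum_bin (m : nat) (delta : {set {set 'I_m}} -> int) (p : nat) :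
  overlap delta p = (\sum_(b in blocks m) 'C(degree delta b, p))%N.
Proof.
transitivity (\sum_(S : {set {set 'I_m}} |
    (S \subset neg_pasch delta) && (#|S| == p))
    'C(#|\bigcap_(rho in S) rho|, 3))%N; last first.
  rewrite -sum_bin_card_above sum_blocks; apply: eq_bigr => s s3.
  by rewrite /degree supp_block_of.
case: p => [|[|p]] /=.
- rewrite (big_pred1 set0) => [|S]; first by rewrite big_set0 cardsT card_ord.
  by rewrite /= cards_eq0; case: eqP => [->|]; rewrite ?sub0set ?andbF.
- rewrite (eq_bigr (fun=> 4%N)) => [|S /andP[SN /cards1P[rho eS]]].
    by rewrite sum_nat_cond_const cards_draws bin1 mulnC.
  rewrite eS big_set1 (@card_neg_pasch_elt _ delta) //.
  by rewrite (subsetP SN) // eS set11.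
rewrite -sum1dep_card big_mkcond [RHS]big_mkcond /=.
apply: eq_bigr => S _; rewrite andbA; case: ifP => /= [|].
  by case/andP=> -> /= /eqP ->.
case: ifP => [/andP[SN Sp]|] //= H.
(* At most three common points, so C(., 3) is 1 when there are exactly three and 0 otherwise. *)
have : (#|\bigcap_(rho in S) rho| < 4)%N.
  apply: card_bigcap_lt => [|rho rhoS]; first by rewrite (eqP Sp).
  exact: card_neg_pasch_elt (subsetP SN _ rhoS).
by move: H; rewrite ltnS leq_eqVlt => -> /= /bin_small ->.
Qed.

(** Once the sums are swapped, the inner sum for a block b is 1 if b has degree i and 0 otherwise;
    [degree_le] justifies stopping at p = m - 3. *)
Lemma card_spectral_class (m : nat) (delta : {set {set 'I_m}} -> int)
    (i : nat) :
  #|spectral_class delta i|%:Z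
    = \sum_(i <= p < (m - 3).+1)
        (-1) ^+ (p - i) * ('C(p, i))%:Z * (overlap delta p)%:Z.
Proof.
under eq_bigr => p _ do
  rewrite overlap_sum_bin -[X in _ * X]natz natr_sum mulr_sumr.
rewrite exchange_big /= -sum1dep_card -[LHS]natz natr_sum.
rewrite [LHS]big_mkcondr; apply: eq_bigr => b bB.
under eq_bigr => p _ do rewrite natz.
by rewrite binomial_inversion_delta ?degree_le //; case: eqP.
Qed.

Theorem corollary5p6 (m : nat) (delta : {set {set 'I_m}} -> int)
    (hm : (3 <= m)%N) (hdelta : is_decoration delta) :
  (forall i : nat, (i <= m - 3)%N ->
     (#|spectral_class delta i|%:Z =
      \sum_(i <= p < (m - 3).+1)
        (-1) ^+ (p - i) * ('C(p, i))%:Z * (overlap delta p)%:Z)) /\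
  (forall delta' : {set {set 'I_m}} -> int, is_decoration delta' ->
     (forall p : nat, (p <= m - 3)%N -> overlap delta p = overlap delta' p) ->
     spectral_profile delta = spectral_profile delta').
Proof.
split=> [i _ | delta' _ eq_overlap]; first exact: card_spectral_class.
(* Both profiles have as i-th entry the same combination of overlap invariants, taken only over p <=
   m - 3. *)
apply: eq_map => i; apply/eqP; rewrite -eqz_nat !card_spectral_class; apply/eqP.
by apply: eq_big_nat => p /andP[_ pm]; rewrite eq_overlap.
Qed.
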